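(* Let $\mathcal{A}\in\mathcal{C}^{n\times n}$, $a=(a_{ij})\in\mathbb{C}^{n\times n}$ and $A=(A_{ij})\in\mathbb{R}_{\min}^{n\times n}$ be such that $(\mathcal{A}_\epsilon)_{ij}\simeq a_{ij}\epsilon^{A_{ij}}$ for all $i,j$, and let $\Gamma=(\gamma_1\le\cdots\le\gamma_n)$ be the sequence of min-plus algebraic eigenvalues of $A$. Assume that the eigenvalues $\mathcal{L}^1_\epsilon,\dots,\mathcal{L}^n_\epsilon$ of $\mathcal{A}_\epsilon$ (counted with multiplicities) have first order asymptotics, $\mathcal{L}^i_\epsilon\sim\lambda_i\epsilon^{\Lambda_i}$, and let $\Lambda=(\Lambda_1\le\cdots\le\Lambda_n)$. Then $\Lambda\prec^{\rm w}\Gamma$.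
   Context: $\mathcal{C}$ is the ring of germs at $0^+$ of continuous functions $f:(0,\epsilon_0)\to\mathbb{C}$ (some $\epsilon_0>0$) such that $|f(\epsilon)|\le\epsilon^{-k}$ on $(0,\epsilon_0)$ for some constant $k>0$ (functions coinciding near $0$ are identified). For $f\in\mathcal{C}$, $a\in\mathbb{C}$, $A\in\mathbb{R}\cup\{+\infty\}$: $f(\epsilon)\simeq a\epsilon^A$ means $\lim_{\epsilon\to0^+}\epsilon^{-A}f(\epsilon)=a$ if $A\in\mathbb{R}$, and $f=0$ (near $0$) if $A=+\infty$. One says that $f\in\mathcal{C}$ has first order asymptotics, $f\sim a\epsilon^A$, if $f\simeq a\epsilon^A$ and either $A\in\mathbb{R}$, $a\ne0$, or $A=+\infty$. $\mathcal{A}_\epsilon$ is the value at $\epsilon$ of (a representative of) $\mathcal{A}$. $\mathbb{R}_{\min}=\mathbb{R}\cup\{+\infty\}$ is the min-plus semifield, with addition $a\oplus b=\min(a,b)$, multiplication $ab=a+b$ (usual sum), zero element $+\infty$ and unit element $0$. A formal polynomial $P=\bigoplus_{k=0}^n P_k\mathsf{Y}^k$ of degree $n$ over $\mathbb{R}_{\min}$ (so $P_n\ne+\infty$) has associated polynomial function $\widehat P(y)=\min_k(P_k+ky)$, $y\in\mathbb{R}_{\min}$ (the term $k=0$ being $P_0$). It factors uniquely as $\widehat P(y)=P_n+\sum_{i=1}^n\min(y,c_i)$ with $c_1\le\cdots\le c_n$ in $\mathbb{R}_{\min}$; the $c_i$ are the (min-plus) roots of $P$. For $A\in\mathbb{R}_{\min}^{n\times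 n}$, the min-plus characteristic polynomial is $P_A=\bigoplus_{k=0}^n (P_A)_k\mathsf{Y}^k$ with $(P_A)_n=0$ and, for $0\le k\le n-1$, $(P_A)_k=\min_{J\subset[n],\,\#J=n-k}\ \min_{\sigma\in\mathfrak{S}_J}\sum_{j\in J}A_{j\sigma(j)}$, where $[n]=\{1,\dots,n\}$ and $\mathfrak{S}_J$ is the set of permutations of $J$. The min-plus algebraic eigenvalues of $A$ are the $n$ roots of $P_A$. For $u,v\in\mathbb{R}_{\min}^n$ with increasingly ordered entries $u_{(1)}\le\cdots\le u_{(n)}$ and $v_{(1)}\le\cdots\le v_{(n)}$, $u\prec^{\rm w}v$ ($u$ is weakly (super) majorized by $v$) means $u_{(1)}+\cdots+u_{(k)}\ge v_{(1)}+\cdots+v_{(k)}$ for all $k=1,\dots,n$ (usual sums in $\mathbb{R}\cup\{+\infty\}$). *)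

(* Defs.v *)
(* The complex numbers over R : realType are R[i] (mathcomp-real-closed). *)
From HB Require Import structures.
From mathcomp Require Export all_boot all_order all_algebra all_fingroup.
From mathcomp Require Export all_classical all_reals all_analysis.
From mathcomp Require Export complex.

Set Implicit Arguments.
Unset Strict Implicit.
Unset Printing Implicit Defensive.

Export Order.TTheory GRing.Theory Num.Theory.
Export numFieldNormedType.Exports.

#[global] Open Scope classical_set_scope.
#[global] Open Scope ring_scope.
#[global] Open Scope complex_scope.

(* Germs at 0^+ are handled through representatives, which are total functions
   on R whose values outside a right neighbourhood of 0 are irrelevant.  The
   topology of the complex numbers is that of the regular module R[i]^o. *)
Definition germC (R : realType) : set (R -> R[i]) :=
  [set f | exists e0 : R, 0 < e0 /\
    {in `]0, e0[, continuous (f : R -> R[i]^o)} /\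
    exists k : R, 0 < k /\
      forall e : R, 0 < e < e0 -> `|f e| <= (e `^ (- k))%:C].

(* The carrier of the min-plus semifield, as a part of \bar R.  On it the sum
   of \bar R is the usual one (the convention -oo + +oo = -oo plays no role). *)
Definition Rmin (R : realType) : {pred \bar R} := [pred x | x != -oo%E].

(* f(e) \simeq a e^A *)
Definition asymp_simeq (R : realType) (f : R -> R[i]) (a : R[i]) (A : \bar R) :
    Prop :=
  match A with
  | r%:E => ((e `^ (- r))%:C * f e : R[i]^o) @[e --> 0^'+] --> (a : R[i]^o)
  | +oo%E => \forall e \near 0^'+, f e = 0
  | -oo%E => False
  end.

(* f \sim a e^A, for f a germ *)
Definition first_order_asymp (R : realType) (f : R -> R[i]) (a : R[i])
    (A : \bar R) : Prop :=
  [/\ germC f, asymp_simeq f a A &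
      (A \is a fin_num /\ a != 0) \/ A = +oo%E].

(* P represents a formal min-plus polynomial of degree n by its n + 1
   coefficients.  Note that y *+ 0 = 0, also when y = +oo. *)
Definition minplus_polyfun (R : realType) (n : nat) (P : 'I_n.+1 -> \bar R)
    (y : \bar R) : \bar R :=
  \big[Order.min/+oo%E]_(k < n.+1) (P k + y *+ k)%E.

(* c is the sequence of min-plus roots of P, in nondecreasing order, P being
   of degree n, that is P ord_max != +oo *)
Definition minplus_roots (R : realType) (n : nat) (P : 'I_n.+1 -> \bar R)
    (c : n.-tuple (\bar R)) : Prop :=
  [/\ all (mem (@Rmin R)) c, sorted <=%O c &
      forall y : \bar R, y \in @Rmin R ->
        minplus_polyfun P y =
        (P ord_max + \sum_(i < n) Order.min y (tnth c i))%E].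

(* The permutations of J are seen as those permutations of 'I_n that fix the
   complement of J pointwise. *)
Definition minplus_charpoly (R : realType) (n : nat) (A : 'M[\bar R]_n)
    (k : 'I_n.+1) : \bar R :=
  if k == ord_max then 0%E else
  \big[Order.min/+oo%E]_(J : {set 'I_n} | #|J| == (n - k)%N)
    \big[Order.min/+oo%E]_(s : {perm 'I_n} | perm_on J s)
      (\sum_(j in J) A j (s j))%E.

Definition minplus_eigenvalues (R : realType) (n : nat) (A : 'M[\bar R]_n)
    (c : n.-tuple (\bar R)) : Prop :=
  minplus_roots (minplus_charpoly A) c.

(* u is weakly (super) majorized by v *)
Definition weak_majorized (R : realType) (n : nat) (u v : n.-tuple (\bar R)) :
    Prop :=
  forall k : nat, (1 <= k <= n)%N ->
    (\sum_(x <- take k (sort <=%O v)) x <=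
     \sum_(x <- take k (sort <=%O u)) x)%E.

(* The functions L i give, near 0^+, the eigenvalues of cA e counted with
   (algebraic) multiplicities. *)
Definition eigenvalue_branches (R : realType) (n : nat)
    (cA : R -> 'M[R[i]]_n) (L : 'I_n -> R -> R[i]) : Prop :=
  \forall e \near 0^'+, char_poly (cA e) = \prod_(i < n) ('X - (L i e)%:P).

(* Main.v *)
Require Import Defs.
From mathcomp Require Import lra.

(* For y real and z a nonzero complex number distinct from every lambda_i,
   evaluate det (z e^y I - cA_e) in two ways.  As the characteristic polynomial
   it is the product of the factors z e^y - L_i, none of which has a vanishing
   leading coefficient, so that its order is exactly sum_i min(y, Lambda_i).
   By the Leibniz formula its order is at least the value at y of the min-plus
   characteristic polynomial of A, that is sum_i min(y, gamma_i).  Hence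
   sum_i min(y, gamma_i) <= sum_i min(y, Lambda_i) for all y, and taking
   y = gamma_k (or y -> +oo if gamma_k = +oo) gives the majorization. *)

Set Implicit Arguments.
Unset Strict Implicit.
Unset Printing Implicit Defensive.

(** * Limits and asymptotic orders at [0^+] *)

Definition right_cvg (R : realType) (f : R -> R[i]) (a : R[i]) : Prop :=
  (f e : R[i]^o) @[e --> 0^'+] --> (a : R[i]^o).

(* Infinitesimal with respect to every e^r with r < B: for B = +oo this is
   weaker than vanishing near 0, but it is enough and needs no case analysis. *)
Definition order_ge (R : realType) (f : R -> R[i]) (B : \bar R) : Prop :=
  forall r : R, (r%:E < B)%E -> right_cvg (fun e => (e `^ (- r))%:C * f e) 0.

Section Asymptotics.
Variable R : realType.
Implicit Types (f g : R -> R[i]) (a b c : R[i]) (A B : \bar R) (r s x : R).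

Lemma right_cvg_near f g a : (\forall e \near 0^'+, f e = g e) ->
  right_cvg f a -> right_cvg g a.
Proof. by move=> fg; apply: cvg_trans; exact: near_eq_cvg. Qed.

Lemma right_cvg_cst a : right_cvg (fun=> a) a.
Proof. exact: cvg_cst. Qed.

Lemma right_cvgM f g a b :
  right_cvg f a -> right_cvg g b -> right_cvg (fun e => f e * g e) (a * b).
Proof. exact: cvgM. Qed.

Lemma right_cvgD f g a b :
  right_cvg f a -> right_cvg g b -> right_cvg (fun e => f e + g e) (a + b).
Proof. exact: cvgD. Qed.

Lemma right_cvg_unique f a b : right_cvg f a -> right_cvg f b -> a = b.
Proof. exact: (cvg_unique (@norm_hausdorff _ R[i]^o)). Qed.

Lemma near_right_gt0 : \forall e \near (0 : R)^'+, 0 < e.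
Proof. exact: nbhs_right_gt. Qed.

Lemma right_cvg_powR0 x : 0 < x -> right_cvg (fun e => (e `^ x)%:C) 0.
Proof.
(* A positive element of [R[i]] has zero imaginary part, so the radius is a real [d] and the real
   limit [powR_cvg0] applies. *)
move=> x0; apply/cvgr0Pnorm_lt => -[d i0]; rewrite ltcE /= => /andP[/eqP -> d0].
have /cvgr0Pnorm_lt/(_ _ d0) := powR_cvg0 x0.
apply: filterS => e; rewrite normc_def /= expr0n addr0 sqrtr_sqr.
by rewrite -[_ +i* _]/(d%:C) ltcR.
Qed.

Lemma powRC_split r s e : 0 < e ->
  (e `^ (r + s))%:C = (e `^ r)%:C * (e `^ s)%:C :> R[i].
Proof.
move=> e0; rewrite powRD ?(gt_eqF e0) ?implybT//.
exact: (rmorphM (real_complex R)).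
Qed.

Lemma right_cvgN f a : right_cvg f a -> right_cvg (fun e => - f e) (- a).
Proof. exact: cvgN. Qed.

(* Stated because unification otherwise unfolds the complex product. *)
Lemma asymp_simeq_fin f a r :
  right_cvg (fun e => (e `^ (- r))%:C * f e) a -> asymp_simeq f a r%:E.
Proof. exact. Qed.

Lemma fin_asymp_simeq f a r :
  asymp_simeq f a r%:E -> right_cvg (fun e => (e `^ (- r))%:C * f e) a.
Proof. exact. Qed.

Lemma asymp_simeq_near f g a A : (\forall e \near 0^'+, f e = g e) ->
  asymp_simeq f a A -> asymp_simeq g a A.
Proof.
move=> fg; case: A => [r||] //=; last by apply: filterS2 fg => e ->.
by apply: right_cvg_near; apply: filterS fg => e ->.
Qed.

Lemma asymp_simeqM f g a b r s :
  asymp_simeq f a r%:E -> asymp_simeq g b s%:E ->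
  asymp_simeq (fun e => f e * g e) (a * b) (r + s)%:E.
Proof.
move=> /fin_asymp_simeq fa /fin_asymp_simeq gb; apply: asymp_simeq_fin.
apply: right_cvg_near (right_cvgM fa gb).
apply: filterS near_right_gt0 => e e0.
by rewrite mulrACA -(powRC_split _ _ e0) -opprD.
Qed.

Lemma asymp_simeq_cst a : asymp_simeq (fun=> a) a 0%:E.
Proof.
apply: asymp_simeq_fin; apply: right_cvg_near (@right_cvg_cst a).
by apply: nearW => e; rewrite oppr0 powRr0 mul1r.
Qed.

Lemma asymp_simeq_prod (I : Type) (t : seq I) (f : I -> R -> R[i])
    (a : I -> R[i]) (r : I -> R) :
  (forall i, asymp_simeq (f i) (a i) (r i)%:E) ->
  asymp_simeq (fun e => \prod_(i <- t) f i e) (\prod_(i <- t) a i)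
    (\sum_(i <- t) r i)%:E.
Proof.
move=> fa; elim: t => [|i t IH].
  rewrite !big_nil; apply: asymp_simeq_near (@asymp_simeq_cst 1).
  by apply: nearW => e; rewrite big_nil.
rewrite !big_cons; apply: asymp_simeq_near (asymp_simeqM (fa i) IH).
by apply: nearW => e; rewrite big_cons.
Qed.

(** For finite [A = s] and [r < s], [e^(-r) f] is the infinitesimal [e^(s-r)] times the convergent
    [e^(-s) f]. *)
Lemma asymp_simeq_order_ge f a A : asymp_simeq f a A -> order_ge f A.
Proof.
case: A => [s||[]]; last first.
  move=> fa r _; apply: right_cvg_near (@right_cvg_cst 0).
  by apply: filterS fa => e ->; rewrite mulr0.
move=> /fin_asymp_simeq fa r; rewrite lte_fin -subr_gt0 => rs.
rewrite -(mul0r a); apply: right_cvg_near (right_cvgM (right_cvg_powR0 rs) fa).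
apply: filterS near_right_gt0 => e e0.
by rewrite mulrA -(powRC_split _ _ e0) addrAC subrr add0r.
Qed.

Lemma order_ge_le f A B : (B <= A)%E -> order_ge f A -> order_ge f B.
Proof. by move=> BA fA r rB; apply: fA; exact: lt_le_trans BA. Qed.

Lemma order_geD f g A : order_ge f A -> order_ge g A ->
  order_ge (fun e => f e + g e) A.
Proof.
move=> fA gA r rA; rewrite -(addr0 0).
apply: right_cvg_near (right_cvgD (fA _ rA) (gA _ rA)).
by apply: nearW => e; rewrite mulrDr.
Qed.

Lemma order_geMl c f A : order_ge f A -> order_ge (fun e => c * f e) A.
Proof.
move=> fA r rA; rewrite -(mulr0 c).
apply: right_cvg_near (right_cvgM (@right_cvg_cst c) (fA _ rA)).
by apply: nearW => e; rewrite mulrCA.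
Qed.

Lemma order_geM f g A B : A != -oo%E -> B != -oo%E ->
  order_ge f A -> order_ge g B -> order_ge (fun e => f e * g e) (A + B)%E.
Proof.
move=> A0 B0 fA gB r rAB.
(* Split [r] as [u + (r - u)] with each part below its own bound: two finite bounds share the slack
   [s + t - r] equally, and an infinite bound absorbs whatever the other one leaves. *)
have [u uA vB] : exists2 u, (u%:E < A)%E & ((r - u)%:E < B)%E.
  move: A B A0 B0 rAB {fA gB} => [s||] // [t||] // _ _; 
    rewrite -?EFinD ?lte_fin => rst.
  - by exists (s - (s + t - r) / 2); rewrite lte_fin; lra.
  - by exists (s - 1); rewrite ?ltry// lte_fin; lra.
  - by exists (r - t + 1); rewrite ?ltry// lte_fin; lra.
  - by exists 0; rewrite ?ltry.
rewrite -(mulr0 0).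
apply: right_cvg_near (right_cvgM (fA _ uA) (gB _ vB)).
apply: filterS near_right_gt0 => e e0.
by rewrite mulrACA -(powRC_split _ _ e0) -opprD addrC subrK.
Qed.

Lemma order_ge_sum (I : Type) (t : seq I) (f : I -> R -> R[i]) A :
  (forall i, order_ge (f i) A) -> order_ge (fun e => \sum_(i <- t) f i e) A.
Proof.
move=> fA; elim: t => [|i t IH] r rA.
  apply: right_cvg_near (@right_cvg_cst 0).
  by apply: nearW => e; rewrite big_nil mulr0.
apply: right_cvg_near (order_geD (fA i) IH rA).
by apply: nearW => e; rewrite big_cons.
Qed.

Lemma order_ge_prod (I : Type) (t : seq I) (f : I -> R -> R[i])
    (A : I -> \bar R) :
  (forall i, A i != -oo%E) -> (forall i, order_ge (f i) (A i)) ->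
  order_ge (fun e => \prod_(i <- t) f i e) (\sum_(i <- t) A i)%E.
Proof.
move=> A0 fA; elim: t => [|i t IH].
  rewrite big_nil; apply: (@asymp_simeq_order_ge _ 1).
  apply: asymp_simeq_near (@asymp_simeq_cst 1).
  by apply: nearW => e; rewrite big_nil.
rewrite big_cons => r rA.
have At : (\sum_(i <- t) A i)%E != -oo%E.
  by elim/big_rec: _ => // j x _; move: (A0 j); case: (A j) x => [?||] // [].
apply: right_cvg_near (order_geM (A0 i) At (fA i) IH rA).
by apply: nearW => e; rewrite big_cons.
Qed.

(** If [r < B], then [e^(-r) f] would tend both to [c != 0] and to [0]. *)
Lemma asymp_simeq_order_le f c r B : c != 0 ->
  asymp_simeq f c r%:E -> order_ge f B -> (B <= r%:E)%E.
Proof.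
move=> c0 /fin_asymp_simeq fc fB; rewrite leNgt; apply/negP => /fB f0.
by move: c0; rewrite (right_cvg_unique fc f0) eqxx.
Qed.

Lemma asymp_simeqDr f g a r B : (r%:E < B)%E ->
  asymp_simeq f a r%:E -> order_ge g B ->
  asymp_simeq (fun e => f e + g e) a r%:E.
Proof.
move=> rB /fin_asymp_simeq fa gB; apply: asymp_simeq_fin; rewrite -(addr0 a).
apply: right_cvg_near (right_cvgD fa (gB _ rB)).
by apply: nearW => e; rewrite mulrDr.
Qed.

Lemma asymp_simeqN f a A : asymp_simeq f a A ->
  asymp_simeq (fun e => - f e) (- a) A.
Proof.
case: A => [r||[]]; last by apply: filterS => e ->; rewrite oppr0.
move=> /fin_asymp_simeq fa; apply: asymp_simeq_fin.
apply: right_cvg_near (right_cvgN fa).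
by apply: nearW => e; rewrite mulrN.
Qed.

Lemma asymp_simeq_monomial c r :
  asymp_simeq (fun e => c * (e `^ r)%:C) c r%:E.
Proof.
apply: asymp_simeq_fin; apply: right_cvg_near (@right_cvg_cst c).
apply: filterS near_right_gt0 => e e0.
by rewrite mulrCA -(powRC_split _ _ e0) addNr powRr0 mulr1.
Qed.

(** The term of smaller order dominates, with coefficient [z] or [- a]; the latter is nonzero
    because [A] is then finite. At equal orders [z != a] prevents cancellation. *)
Lemma asymp_simeq_sub_monomial f a A z r :
  first_order_asymp f a A -> z != 0 -> z != a ->
  exists c s, [/\ c != 0, Order.min r%:E A = s%:E &
    asymp_simeq (fun e => z * (e `^ r)%:C - f e) c s%:E].
Proof.
move=> [_ fa Aa] z0 za; have mz := @asymp_simeq_monomial z r.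
have Nfa := asymp_simeqN fa.
case: (ltgtP r%:E A) => rA.
- exists z, r; split=> //.
  exact: asymp_simeqDr rA mz (asymp_simeq_order_ge Nfa).
- case: A fa Aa rA Nfa => [s||[]] fa Aa rA Nfa; last by [].
  exists (- a), s; split; [by rewrite oppr_eq0; case: Aa => [[]|] | by [] |].
  apply: asymp_simeq_near
    (asymp_simeqDr rA Nfa (asymp_simeq_order_ge mz)).
  by apply: nearW => e; rewrite addrC.
- exists (z - a), r; split; [by rewrite subr_eq0 | by [] |].
  apply: asymp_simeq_fin; rewrite -rA in Nfa.
  apply: right_cvg_near
    (right_cvgD (fin_asymp_simeq mz) (fin_asymp_simeq Nfa)).
  by apply: nearW => e; rewrite mulrDr.
Qed.

End Asymptotics.

(** * Min-plus characteristic polynomial and majorization *)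

Section MinPlus.
Variable R : realType.

Lemma minplus_charpoly_le (n : nat) (A : 'M[\bar R]_n) (k : 'I_n.+1)
    (J : {set 'I_n}) (s : {perm 'I_n}) : #|J| = (n - k)%N -> perm_on J s ->
  (minplus_charpoly A k <= \sum_(j in J) A j (s j))%E.
Proof.
rewrite /minplus_charpoly => cJ sJ; case: eqP => [kn|_].
  move: cJ; rewrite kn subnn => /cards0_eq ->.
  by rewrite big_set0.
apply: (@le_trans _ _ (\big[Order.min/+oo%E]_(s : {perm 'I_n} | perm_on J s)
      (\sum_(j in J) A j (s j))%E)).
  by apply: (@bigmin_le_cond _ _ _ _ J); apply/eqP.
exact: (@bigmin_le_cond _ _ _ _ s).
Qed.

(** The right side is the weight of [s] in the matrix [A] with diagonal entries lowered to
    [min (A i i) y]. It is at least one monomial of the characteristic polynomial: the fixed points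
    where [y] is the minimum give the power of [y], the other indices a permutation of their set. *)
Lemma minplus_polyfun_charpoly_le (n : nat) (A : 'M[\bar R]_n) (y : R)
    (s : {perm 'I_n}) :
  (minplus_polyfun (minplus_charpoly A) y%:E <=
   \sum_i if i == s i then Order.min (A i (s i)) y%:E else A i (s i))%E.
Proof.
(* Off J, the permutation s picks the diagonal entry y. *)
pose J : {set 'I_n} := [set i | ~~ ((s i == i) && (y%:E <= A i i)%E)]%SET.
have Jn : (#|J| <= n)%N by rewrite -[X in (_ <= X)%N]card_ord max_card.
pose k : 'I_n.+1 := Ordinal (leq_subr #|J| n : (n - #|J| < n.+1)%N).
have sJ : perm_on J s.
  apply/fintype.subsetP => i; rewrite !inE negb_and => si.
  by rewrite si.
apply: le_trans (bigmin_le _ k _) _.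
apply: le_trans (leeD2r _ (minplus_charpoly_le (J := J) A _ sJ)) _.
  by rewrite /= subKn.
rewrite [leRHS](bigID (mem J)) /=; apply: leeD.
  apply: lee_sum => i; rewrite inE negb_and -ltNge.
  case: (eqVneq i (s i)) => [<-|//] /=.
  by move=> /ltW Ay; rewrite min_l.
rewrite (eq_bigr (fun=> y%:E)); last first.
  move=> i; rewrite inE negbK => /andP[/eqP -> yA].
  by rewrite eqxx min_r.
rewrite sumEFin sumr_const -EFin_natmul lee_fin.
suff -> : #|[pred i | i \notin J]| = (n - #|J|)%N by [].
by rewrite -[X in (X - _)%N]card_ord -(cardC J) addKn; apply: eq_card.
Qed.

Lemma sum_min_cat (y : R) (u v : seq (\bar R)) :
  (\sum_(x <- u ++ v) Order.min y%:E x <=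
   \sum_(x <- u) x + (y *+ size v)%R%:E)%E.
Proof.
rewrite big_cat /=; apply: leeD.
  by apply: lee_sum => x _; rewrite ge_min lexx orbT.
elim: v => [|x v IH]; first by rewrite big_nil.
by rewrite big_cons /= mulrS EFinD; apply: leeD => //; rewrite ge_min lexx.
Qed.

(** As [v] is sorted and [y] is at most its [k]-th term (index [k.-1]), each later term of [v]
    contributes exactly [y], while each later term of [u] contributes at most [y]. These equal
    finite amounts cancel. *)
Lemma sum_take_min_le (u v : seq (\bar R)) (k : nat) (y : R) :
  size u = size v -> (0 < k <= size v)%N -> sorted <=%O v ->
  (y%:E <= nth 0%E v k.-1)%E ->
  (\sum_(x <- v) Order.min y%:E x <= \sum_(x <- u) Order.min y%:E x)%E ->
  (\sum_(x <- take k v) Order.min y%:E x <= \sum_(x <- take k u) x)%E.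
Proof.
move=> suv /andP[k0 kv] sv yk.
rewrite -{1}(cat_take_drop k v) -{1}(cat_take_drop k u) => uv.
have := le_trans uv (sum_min_cat _ _ _).
rewrite big_cat /= !size_drop suv.
rewrite [X in (_ + X <= _)%E](eq_big_seq (fun=> y%:E)); last first.
  move=> x; case/(nthP 0%E) => i; rewrite size_drop nth_drop => iv <-.
  apply: min_l; apply: (le_trans yk).
  apply: (sorted_leq_nth le_trans le_refl) => //; rewrite ?inE.
  - by rewrite prednK.
  - by rewrite -ltn_subRL.
  - exact: leq_trans (leq_pred k) (leq_addr i k).
rewrite sumEFin big_const_seq count_predT size_drop iter_addr_0.
by rewrite leeD2rE.
Qed.

Lemma weak_majorized_of_sum_min (u v : seq (\bar R)) (k : nat) :
  size u = size v -> (0 < k <= size v)%N -> sorted <=%O v ->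
  all (mem (@Rmin R)) v ->
  (forall y : R, (\sum_(x <- v) Order.min y%:E x <=
                  \sum_(x <- u) Order.min y%:E x)%E) ->
  (\sum_(x <- take k v) x <= \sum_(x <- take k u) x)%E.
Proof.
move=> suv kv sv v0 uv; have /andP[k0 kn] := kv.
have le_y y := @sum_take_min_le u v k y suv kv sv ^~ (uv y).
have k1v : (k.-1 < size v)%N by rewrite prednK.
have : nth 0%E v k.-1 \in @Rmin R by exact: (allP v0) (mem_nth _ k1v).
rewrite inE; case E : (nth 0%E v k.-1) => [g||] // _.
  (* If the [k]-th term of [v] is a real [g], take [y = g]: the truncation by [y] leaves the first
     [k] terms unchanged. *)
  have := le_y g; rewrite E lexx => /(_ isT).
  rewrite (eq_big_seq id)// => x; case/(nthP 0%E) => i.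
  rewrite size_take_min => ik <-.
  rewrite nth_take; last exact: leq_trans ik (geq_minl _ _).
  apply: min_r; rewrite -E.
  apply: (sorted_leq_nth le_trans le_refl) => //; rewrite ?inE.
  - exact: leq_trans ik (geq_minr _ _).
  - by rewrite -ltnS prednK// (leq_trans ik)// geq_minl.
(* If the [k]-th term is [+oo], it contributes [y] itself, and letting [y] grow makes the sum over
   [u] infinite. *)
suff -> : (\sum_(x <- take k u) x = +oo)%E by rewrite leey.
have {}le_y y : 
    (\sum_(x <- take k v) Order.min y%:E x <= \sum_(x <- take k u) x)%E.
  by apply: le_y; rewrite E leey.
rewrite -(prednK k0) (take_nth 0%E k1v) E in le_y.
set w := take k.-1 v in le_y.
(* For [y >= 0] the first [k - 1] terms contribute at least this finite sum, which is independent of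
   [y]. *)
have wfin : (\sum_(x <- w) Order.min 0%:E x)%E \is a fin_num.
  rewrite sum_fin_num filter_predT; apply/allP => ? /mapP[x xw ->].
  have := allP v0 _ (mem_take xw).
  rewrite inE; case: x {xw} => [x||]//= _; last by rewrite min_l ?leey.
  by rewrite -EFin_min.
have lb (y : R) : 0 <= y ->
    ((\sum_(x <- w) Order.min 0%:E x) + y%:E <= \sum_(x <- take k.-1.+1 u) x)%E.
  move=> y0; apply: le_trans (le_y y); rewrite -cats1 big_cat big_seq1 /=.
  rewrite (min_l (leey _)) leeD2r//; apply: lee_sum => x _.
  by rewrite le_min !ge_min lexx orbT lee_fin y0.
rewrite -(prednK k0); move: lb wfin.
case: (\sum_(x <- take _ u) x)%E => [t||] //; case: (\sum_(x <- w) _)%E => // r.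
  (* This [y] makes [r + y] at least [t + 1], contradicting the bound by [t]. *)
  move=> /(_ (Num.max 0 (t - r + 1))); rewrite le_max lexx => /(_ isT).
  rewrite -EFinD lee_fin => lb _.
  exfalso; suff : t - r + 1 <= Num.max 0 (t - r + 1) by lra.
  by rewrite le_max lexx orbT.
by move=> /(_ 0 (lexx _)).
Qed.

End MinPlus.

(** * The two evaluations of the determinant and the conclusion *)

Lemma horner_char_poly (F : comNzRingType) (n : nat) (M : 'M[F]_n) (t : F) :
  (char_poly M).[t] = \det (t%:M - M).
Proof.
rewrite -/(horner_eval t _) -det_map_mx; congr (\det _).
apply/matrixP => i j.
by rewrite !mxE /= /horner_eval hornerD hornerN hornerC hornerMn hornerX.
Qed.

Lemma exists_neq0_neq (F : numFieldType) (n : nat) (lambda : 'I_n -> F) :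
  exists2 z : F, z != 0 & forall i, z != lambda i.
Proof.
(* This [z] is positive and exceeds every [lambda i] in absolute value. *)
pose z : F := 1 + \sum_i `|lambda i|.
have zs : 0 < z by rewrite ltr_wpDr// sumr_ge0.
exists z => [|i]; first by rewrite gt_eqF.
have : `|lambda i| < z.
  by rewrite /z (bigD1 i)//= addrCA ltrDl ltr_wpDr// sumr_ge0.
by apply: contraTneq => <-; rewrite gtr0_norm// ltxx.
Qed.

(** Each Leibniz term is a sign, absorbed as a constant factor, times a product of entries whose
    orders add up. *)
Lemma order_ge_det (R : realType) (n : nat) (M : R -> 'M[R[i]]_n)
    (B : 'M[\bar R]_n) (p : \bar R) :
  (forall i j, B i j != -oo%E) ->
  (forall i j, order_ge (fun e => M e i j) (B i j)) ->
  (forall s : {perm 'I_n}, p <= \sum_i B i (s i))%E ->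
  order_ge (fun e => \det (M e)) p.
Proof.
move=> B0 MB pB; apply: order_ge_sum => s; apply: order_geMl.
by apply: order_ge_le (pB s) _; apply: order_ge_prod.
Qed.

Lemma minplus_polyfun_le_sum_min (R : realType) (n : nat)
    (cA : R -> 'M[R[i]]_n) (a : 'M[R[i]]_n) (A : 'M[\bar R]_n)
    (L : 'I_n -> R -> R[i]) (lambda : 'I_n -> R[i]) (Lambda : 'I_n -> \bar R)
    (y : R) :
  (forall i j, asymp_simeq (fun e => cA e i j) (a i j) (A i j)) ->
  eigenvalue_branches cA L ->
  (forall i, first_order_asymp (L i) (lambda i) (Lambda i)) ->
  (minplus_polyfun (minplus_charpoly A) y%:E <=
   \sum_i Order.min y%:E (Lambda i))%E.
Proof.
move=> cA_A L_eig L_sim.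
have A0 i j : A i j != -oo%E by move: (cA_A i j); case: (A i j).
have [z z0 zl] := exists_neq0_neq lambda.
(* Leading coefficient [c i] and finite exact order [m i] of each factor of the characteristic
   polynomial at [z e^y]. *)
have /choice[c /choice[m cm]] i : exists c m, [/\ c != 0,
    Order.min y%:E (Lambda i) = m%:E &
    asymp_simeq (fun e => z * (e `^ y)%:C - L i e) c m%:E].
  exact: asymp_simeq_sub_monomial (L_sim i) z0 (zl i).
have c0 i : c i != 0 by case: (cm i).
have c_sim i :
    asymp_simeq (fun e => z * (e `^ y)%:C - L i e) (c i) (m i)%:E.
  by case: (cm i).
rewrite (eq_bigr (fun i => (m i)%:E)); last by move=> i _; case: (cm i).
rewrite sumEFin.
apply: (@asymp_simeq_order_le _ (fun e => \det ((z * (e `^ y)%:C)%:M - cA e))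
  (\prod_i c i)).
- by apply/prodf_neq0 => i _.
  apply: asymp_simeq_near (@asymp_simeq_prod _ _ (index_enum 'I_n) _ _ _ c_sim).
  apply: filterS L_eig => e Le; rewrite -horner_char_poly Le horner_prod.
  by apply: eq_bigr => i _; rewrite !hornerE.
(* Lower bounds for the orders of the entries of [z e^y I - cA e]: the monomial [z e^y] affects only
   the diagonal. *)
- pose B := \matrix_(i, j) if i == j then Order.min (A i j) y%:E else A i j.
  apply: (@order_ge_det _ _ _ B) => [i j|i j|s].
  + by rewrite mxE; case: ifP => // _; rewrite minEle; case: ifP.
  + have Aij := asymp_simeq_order_ge (asymp_simeqN (cA_A i j)).
    rewrite mxE (_ : (fun e => _) =
      fun e => z * (e `^ y)%:C *+ (i == j) - cA e i j); last first.
      by apply/funext => e; rewrite !mxE.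
    case: (eqVneq i j) => [_|_] /=; last by under eq_fun do rewrite add0r.
    apply: order_geD; last by apply: order_ge_le Aij; rewrite ge_min lexx.
    apply: order_ge_le (asymp_simeq_order_ge (@asymp_simeq_monomial R z y)).
    by rewrite ge_min lexx orbT.
  + apply: le_trans (minplus_polyfun_charpoly_le A y s) _.
    by apply: lee_sum => i _; rewrite mxE.
Qed.

Theorem theorem7p1 (R : realType) (n : nat)
    (cA : R -> 'M[R[i]]_n) (a : 'M[R[i]]_n) (A : 'M[\bar R]_n)
    (Gamma : n.-tuple (\bar R))
    (L : 'I_n -> R -> R[i]) (lambda : 'I_n -> R[i]) (Lambda : n.-tuple (\bar R))
    (cA_germ : forall i j, germC (fun e => cA e i j))
    (A_Rmin : forall i j, A i j \in @Rmin R)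
    (cA_simeq : forall i j, asymp_simeq (fun e => cA e i j) (a i j) (A i j))
    (Gamma_eig : minplus_eigenvalues A Gamma)
    (L_eig : eigenvalue_branches cA L)
    (Lambda_Rmin : forall i, tnth Lambda i \in @Rmin R)
    (L_sim : forall i, first_order_asymp (L i) (lambda i) (tnth Lambda i)) :
  weak_majorized Lambda Gamma.
Proof.
case: Gamma_eig => G0 Gsorted GP k kn.
rewrite (sorted_sort le_trans Gsorted).
apply: weak_majorized_of_sum_min => //; rewrite ?size_sort ?size_tuple//.
(* The sum of truncations is invariant under reordering, which returns from the sorted sequence to
   the indexing of the branches. *)
move=> y; rewrite [leRHS](perm_big Lambda) ?perm_sort// !big_tuple.
have := minplus_polyfun_le_sum_min y cA_simeq L_eig L_sim.
(* The leading coefficient is [0], so the factorization of the polynomial function is exactly the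
   sum of the [min y] over [Gamma]. *)
by rewrite GP ?inE// /minplus_charpoly eqxx add0e.
Qed.
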